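(* Let $H$ be the graph on vertex set $\{0,1,2,3\}$ whose edges are one red edge $\{0,1\}$ and two blue edges $\{0,2\}$ and $\{0,3\}$. Let $n\ge 4$ be an integer. (1) If $n$ is congruent to $1$, $2$ or $4$ modulo $6$, then $\Lambda_H(n)=n\,\pi_3(2n-3)/2$, and a graph $G$ of order $n$ satisfies $\Lambda_H(G)=\Lambda_H(n)$ if and only if $G$ is $\lfloor n/3\rfloor$-regular. (2) If $n=6k$ for an integer $k$, then $\Lambda_H(n)=n\,\pi_3(2n-3)/2-3k(4k-1)$, and a graph $G$ of order $n$ satisfies $\Lambda_H(G)=\Lambda_H(n)$ if and only if every vertex of $G$ has degree $2k-1$ or $2k$. (3) If $n=6k+3$ for an integer $k$, then $\Lambda_H(n)=n\,\pi_3(2n-3)/2-(6k+3)(4k+1)/2$, and a graph $G$ of order $n$ satisfies $\Lambda_H(G)=\Lambda_H(n)$ if and only if every vertex of $G$ has degree $2k$ or $2k+1$. (4) If $n=6k+5$ for an integer $k$, then $\Lambda_H(n)=n\,\pi_3(2n-3)/2-4k-2$, and a graph $G$ of order $n$ satisfies $\Lambda_H(G)=\Lambda_H(n)$ if and only if $G$ has $n-1$ vertices of degree $2k+1$ and one vertex of degree $2k+2$.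
   Context: All graphs are finite and simple; the order of a graph is its number of vertices. For a graph $H$ whose edges are coloured red or blue and an uncoloured graph $G$, an embedding of $H$ into $G$ is an injection $V(H)\to V(G)$ that maps red edges of $H$ to edges of $G$ and blue edges of $H$ to non-edges of $G$ (pairs of distinct non-adjacent vertices). $\Lambda_H(G)$ is the number of embeddings of $H$ into $G$, and $\Lambda_H(n)$ is the maximum of $\Lambda_H(G)$ over all graphs $G$ of order $n$. For non-negative integers $N$, $\pi_3(N)$ denotes the maximum product of three non-negative integers that sum to $N$, i.e. $\pi_3(N)=\lfloor N/3\rfloor\lfloor (N+1)/3\rfloor\lfloor (N+2)/3\rfloor$. *)

(* Defs.v *)
From HB Require Import structures.
From mathcomp Require Import all_boot all_order all_algebra.

Set Implicit Arguments.
Unset Strict Implicit.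
Unset Printing Implicit Defensive.

Record sgraph (T : finType) := SGraph {
  edges : {set {set T}};
  edges_card2 : [forall e in edges, #|e| == 2]
}.

HB.instance Definition _ (T : finType) := [isSub for @edges T].
HB.instance Definition _ (T : finType) := [Finite of sgraph T by <:].

Definition adj (T : finType) (G : sgraph T) : rel T :=
  fun x y => [set x; y] \in edges G.

Definition nonedges (T : finType) (G : sgraph T) : {set {set T}} :=
  [set e : {set T} | (#|e| == 2) && (e \notin edges G)].

Definition deg (T : finType) (G : sgraph T) (x : T) : nat :=
  #|[set y | adj G x y]|.

Definition regular (T : finType) (G : sgraph T) (d : nat) : Prop :=
  forall x : T, deg G x = d.

(* A graph with edge set [edges red :|: edges blue]; disjointness says that
   every edge receives exactly one colour. *)
Record rbgraph (V : finType) := RBGraph {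
  red : sgraph V;
  blue : sgraph V;
  red_blue_disjoint : [disjoint edges red & edges blue]
}.

Definition embedding (V T : finType) (H : rbgraph V) (G : sgraph T)
    (f : {ffun V -> T}) : bool :=
  [&& injectiveb f,
      [forall e in edges (red H), f @: e \in edges G] &
      [forall e in edges (blue H), f @: e \in nonedges G]].

Definition Lambda (V T : finType) (H : rbgraph V) (G : sgraph T) : nat :=
  #|[set f : {ffun V -> T} | embedding H G f]|.

(* [Lambda H G] is invariant under isomorphism of [G], so the maximum over all
   graphs of order [n] may be taken over the graphs with vertex set ['I_n]. *)
Definition LambdaMax (V : finType) (H : rbgraph V) (n : nat) : nat :=
  \max_(G : sgraph 'I_n) Lambda H G.

Definition pi3 (N : nat) : nat :=
  \max_(t : 'I_N.+1 * 'I_N.+1 * 'I_N.+1 | t.1.1 + t.1.2 + t.2 == N)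
    t.1.1 * t.1.2 * t.2.

Definition v0 : 'I_4 := @Ordinal 4 0 isT.
Definition v1 : 'I_4 := @Ordinal 4 1 isT.
Definition v2 : 'I_4 := @Ordinal 4 2 isT.
Definition v3 : 'I_4 := @Ordinal 4 3 isT.

Fact H_red_card2 :
  [forall e in [set [set v0; v1]], #|e : {set 'I_4}| == 2].
Proof. by apply/forall_inP => e /set1P ->; rewrite cards2. Qed.

Fact H_blue_card2 :
  [forall e in [set [set v0; v2]; [set v0; v3]], #|e : {set 'I_4}| == 2].
Proof. by apply/forall_inP => e /set2P[] ->; rewrite cards2. Qed.

Fact H_disjoint :
  [disjoint edges (SGraph H_red_card2) & edges (SGraph H_blue_card2)].
Proof.
apply/pred0P => e /=; apply/negP => /andP[/set1P -> /set2P[] /setP/(_ v1)];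
  by rewrite !inE.
Qed.

Definition H : rbgraph 'I_4 := RBGraph H_disjoint.

(* Main.v *)
Require Import Defs.
From mathcomp Require Import all_boot all_order all_algebra.
From mathcomp Require Import zify ring.
Import GRing.Theory Num.Theory.
Local Open Scope nat_scope.

(** Counting embeddings by the image [x] of vertex [0] gives
    [Lambda H G = \sum_x d (n-1-d) (n-2-d)] with [d = deg x], so only the degree
    sequence matters.  Twice the summand is a product of three integers with
    sum [2n-3], and the cubic [d (n-1-d) (n-2-d)] is maximised at one or two explicit
    values of [d] near [n/3].  Circulant graphs realise these degrees, except when
    [n = 6k+5]: there the only optimal degree [2k+1] and [n] are both odd, so by
    the handshake lemma some vertex has another degree, and the second best
    value is attained only at [2k+2]. *)

(** * Degrees, non-neighbours and the handshake lemma *)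

Lemma adjC {T : finType} (G : sgraph T) x y : adj G x y = adj G y x.
Proof. by rewrite /adj setUC. Qed.

Lemma adj_neq {T : finType} {G : sgraph T} {x y} : adj G x y -> x != y.
Proof.
move=> Gxy; have /forall_inP/(_ _ Gxy) := edges_card2 G.
by rewrite cards2 eqSS; case: (x != y).
Qed.

Lemma adj_irr {T : finType} (G : sgraph T) x : adj G x x = false.
Proof. by apply/negP => /adj_neq; rewrite eqxx. Qed.

Definition nonnbr {T : finType} (G : sgraph T) x :=
  [set y | (y != x) && ~~ adj G x y].

Lemma card_nonnbr {T : finType} (G : sgraph T) x :
  #|nonnbr G x| = #|T|.-1 - deg G x.
Proof.
have -> : nonnbr G x = ~: (x |: [set y | adj G x y]).
  by apply/setP => y; rewrite !inE negb_or.
have := cardsC (x |: [set y | adj G x y]).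
rewrite cardsU1 inE adj_irr /= -/(deg G x); lia.
Qed.

Lemma nonedgesE {T : finType} (G : sgraph T) x y :
  ([set x; y] \in nonedges G) = (y \in nonnbr G x).
Proof. by rewrite !inE cards2 eqSS eqb1 eq_sym. Qed.

Lemma deg_lt {T : finType} (G : sgraph T) x : deg G x < #|T|.
Proof.
rewrite -cardsT; apply/proper_card/properP; split; first exact: subsetT.
by exists x; rewrite ?inE ?adj_irr.
Qed.

(** Split each degree by [enum_rank] into neighbours of larger and of smaller rank. By symmetry of
    [adj], both parts have the same total over all vertices. *)
Lemma sum_deg_even {T : finType} (G : sgraph T) : ~~ odd (\sum_x deg G x).
Proof.
have degE x : deg G x = \sum_(y | enum_rank x < enum_rank y) adj G x y
                      + \sum_(y | enum_rank y < enum_rank x) adj G x y.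
  rewrite /deg -sum1dep_card [LHS]big_mkcond.
  rewrite [LHS](bigID (fun y => enum_rank x < enum_rank y)) /=.
  congr (_ + _).
  rewrite [RHS]big_mkcond [LHS]big_mkcond; apply: eq_bigr => y _ /=.
  case: ltngtP => [||/val_inj/enum_rank_inj xy] /=;
    [by [] | by case: (adj G x y) | by rewrite xy adj_irr].
under eq_bigr => x _ do rewrite degE.
rewrite big_split /= [X in _ + X](exchange_big_dep xpredT) //=.
under [X in _ + X]eq_bigr => x _ do under eq_bigr => y _ do rewrite adjC.
by rewrite addnn odd_double.
Qed.

(** * Counting embeddings by the image of vertex 0 *)

Lemma card_offdiag {T : finType} (A : {set T}) :
  #|[set p in setX A A | p.1 != p.2]| = #|A| * #|A|.-1.
Proof.
have -> : [set p in setX A A | p.1 != p.2] = setX A A :\: [set (x, x) | x in A].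
  apply/setP => -[x y]; rewrite !inE /= andbC; case: (eqVneq x y) => [<-|nxy] /=.
    case: (boolP (x \in A)) => xA /=; last by rewrite andbF.
    by rewrite imset_f.
  by case: imsetP => // -[z _ [xz yz]]; case/eqP: nxy; rewrite xz yz.
rewrite cardsDS; last by apply/subsetP => _ /imsetP[x xA ->]; rewrite inE /= xA.
rewrite cardsX card_imset; last by move=> x y [].
by case: #|A| => // a; lia.
Qed.

(** The nesting isolates the image of vertex 0, over which the count is then summed. The default
    [p.1] of [nth] is never reached, since [i < 4]. *)
Definition quad {T : finType} (p : T * (T * (T * T))) : {ffun 'I_4 -> T} :=
  [ffun i : 'I_4 => nth p.1 [:: p.1; p.2.1; p.2.2.1; p.2.2.2] i].

Lemma quad_bij {T : finType} : bijective (@quad T).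
Proof.
exists (fun f : {ffun _ -> T} => (f v0, (f v1, (f v2, f v3)))).
  by move=> [a [b [c d]]]; rewrite !ffunE.
move=> f; apply/ffunP => i; rewrite ffunE /=.
by case: i => [] [|[|[|[|//]]]] ?; congr (f _); apply: val_inj.
Qed.

(** Neighbours and non-neighbours of the centre are disjoint and exclude the centre, so injectivity
    only asks that the two blue leaves differ. *)
Lemma embeddingE {T : finType} (G : sgraph T) (p : T * (T * (T * T))) :
  embedding H G (quad p) =
  (p.2 \in setX [set y | adj G p.1 y]
           [set q in setX (nonnbr G p.1) (nonnbr G p.1) | q.1 != q.2]).
Proof.
case: p => [a [b [c d]]] /=.
have im (i j : 'I_4) (f : {ffun 'I_4 -> T}) : f @: [set i; j] = [set f i; f j].
  by rewrite imsetU1 imset_set1.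
have redE : [forall e in edges (red H), quad (a, (b, (c, d))) @: e \in edges G]
            = adj G a b.
  apply/forall_inP/idP => [/(_ _ (set11 _))|ab e /set1P ->]; by rewrite im !ffunE.
have blueE : [forall e in edges (blue H), quad (a, (b, (c, d))) @: e \in nonedges G]
            = (c \in nonnbr G a) && (d \in nonnbr G a).
  apply/forall_inP/andP => [h|[ac ad] e /set2P[]->].
  - by split; [have := h _ (set21 _ _)|have := h _ (set22 _ _)];
      rewrite im !ffunE nonedgesE.
  - by rewrite im !ffunE nonedgesE.
  - by rewrite im !ffunE nonedgesE.
rewrite /embedding redE blueE !inE /=.
case: (boolP (adj G a b)) => [ab|]; last by rewrite andbF.
rewrite !andTb.
case: (boolP ((c != a) && ~~ adj G a c)) => [/andP[ca nac]|]; last by rewrite andbF.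
case: (boolP ((d != a) && ~~ adj G a d)) => [/andP[da nad]|]; last by rewrite /= ?andbF.
rewrite !andbT !andTb.
have nab := adj_neq ab.
have nbc : b != c by apply: contraNneq nac => <-.
have nbd : b != d by apply: contraNneq nad => <-.
apply/injectiveP/idP => [inj|ncd].
  by apply/eqP => cd; have := inj v2 v3; rewrite !ffunE /= => /(_ cd).
move=> i j; rewrite !ffunE.
have Uq : uniq [:: a; b; c; d].
  by rewrite /= !inE !negb_or nab nbc nbd ncd (eq_sym a c) (eq_sym a d) ca da.
by move/eqP; rewrite nth_uniq // => /eqP/val_inj.
Qed.

Definition star_count n d := d * ((n.-1 - d) * (n.-1 - d).-1).

Lemma LambdaE {T : finType} (G : sgraph T) :
  Lambda H G = \sum_x star_count #|T| (deg G x).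
Proof.
rewrite /Lambda -sum1dep_card (reindex quad); last exact: onW_bij quad_bij.
under eq_bigl => p do rewrite embeddingE.
rewrite -(pair_big_dep xpredT (fun x p => p \in setX [set y | adj G x y]
           [set q in setX (nonnbr G x) (nonnbr G x) | q.1 != q.2])
           (fun _ _ => 1)) /=.
apply: eq_bigr => x _.
by rewrite sum1_card cardsX card_offdiag card_nonnbr.
Qed.

(** * Circulant graphs with prescribed degrees *)

Definition rel_graph {T : finType} (r : rel T) : {set {set T}} :=
  [set [set p.1; p.2] | p : T * T & (p.1 != p.2) && (r p.1 p.2)].

Fact rel_graph_card2 {T : finType} (r : rel T) :
  [forall e in rel_graph r, #|e| == 2].
Proof.
apply/forall_inP => e /imsetP[p]; rewrite inE => /andP[np _] ->.
by rewrite cards2 np.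
Qed.

Lemma deg_rel_graph {T : finType} (r : rel T) x :
  symmetric r -> irreflexive r ->
  deg (SGraph (rel_graph_card2 r)) x = #|[set y | r x y]|.
Proof.
move=> rC rirr; congr #|pred_of_set _|; apply/setP => y; rewrite !inE /adj /=.
apply/imsetP/idP => [[[a b]]|rxy]; last first.
  by exists (x, y); rewrite ?inE //= rxy andbT; apply: contraTneq rxy => ->; rewrite rirr.
rewrite inE /= => /andP[nab rab] E.
have: x \in [set a; b] by rewrite -E set21.
have: y \in [set a; b] by rewrite -E set22.
have: a \in [set x; y] by rewrite E set21.
have: b \in [set x; y] by rewrite E set22.
rewrite !inE.
do 4! [case/orP => /eqP ?]; subst; rewrite ?eqxx // in nab *; by rewrite // rC.
Qed.

(* The circulant graph with distances [1..m], to which [c] adds the pairs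
   [i, i + n./2] with no wrap-around: a perfect matching if [n] is even; if [n] is
   odd, every vertex is covered once except the middle one, covered twice. *)
Definition circ (n m : nat) (c : bool) : rel 'I_n := fun i j =>
  let t := (i - j) + (j - i) in
  [|| 0 < t <= m, n - m <= t | c && (t == n./2)].

Lemma circ_sym n m c : symmetric (circ n m c).
Proof. by move=> i j; rewrite /circ addnC. Qed.

Lemma circ_irr n m c : m < n./2 -> irreflexive (circ n m c).
Proof. by move=> mn i; rewrite /circ; lia. Qed.

(** Induction on [m]: each new distance adds two vertices, which are distinct because twice the
    distance is less than [n]. *)
Lemma card_circ n m i : m < n./2 -> #|[set j | circ n m false i j]| = m.*2.
Proof.
elim: m => [|m IHm] mn.
  apply/eqP; rewrite cards_eq0; apply/eqP/setP => j; rewrite !inE /circ.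
  have := ltn_ord i; have := ltn_ord j; lia.
have hi := ltn_ord i.
(* [p] and [q] are [i + m.+1] and [i - m.+1] modulo [n]. *)
have [p hp] : exists p : 'I_n, (p = i + m.+1 :> nat) \/ (p + n = i + m.+1).
  have [h|h] := ltnP (i + m.+1) n; first by exists (Ordinal h); left.
  have h' : i + m.+1 - n < n by lia.
  by exists (Ordinal h'); right => /=; lia.
have [q hq] : exists q : 'I_n, (q + m.+1 = i) \/ (q + m.+1 = i + n).
  have [h|h] := leqP m.+1 i.
    have h' : i - m.+1 < n by lia.
    by exists (Ordinal h'); left => /=; lia.
  have h' : i + n - m.+1 < n by lia.
  by exists (Ordinal h'); right => /=; lia.
have hp' := ltn_ord p; have hq' := ltn_ord q.
have -> : [set j | circ n m.+1 false i j] =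
   p |: (q |: [set j | circ n m false i j]).
  apply/setP => j; rewrite !inE /circ -!val_eqE /=.
  have := ltn_ord j; lia.
rewrite !cardsU1 IHm ?inE ?/circ -?val_eqE /=; lia.
Qed.

Lemma card_circ_half n m i : m < n./2 ->
  #|[set j | circ n m true i j]| = m.*2 + (1 + (odd n && (i == n./2 :> nat))).
Proof.
move=> mn; have hi := ltn_ord i.
have -> : [set j | circ n m true i j] = [set j | circ n m false i j] :|:
   [set j : 'I_n | i - j + (j - i) == n./2].
  by apply/setP => j; rewrite !inE /circ /=; lia.
rewrite cardsU card_circ //.
(* As [m < n./2], the difference [n./2] lies strictly between [m] and [n - m]. *)
set A := _ :&: _; have -> : A = set0.
  by apply/setP => j; rewrite !inE /circ /=; have := ltn_ord j; lia.
rewrite cards0 subn0; congr (_ + _).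
case: (boolP (odd n && (i == n./2 :> nat))) => h.
  (* The middle vertex of an odd order is at difference [n./2] from both ends, 0 and [n.-1]. *)
  have p0 : 0 < n by lia.
  have p1 : n.-1 < n by lia.
  have -> : [set j : 'I_n | i - j + (j - i) == n./2] = [set Ordinal p0; Ordinal p1].
    by apply/setP => j; rewrite !inE -!val_eqE /=; have := ltn_ord j; lia.
  by rewrite cards2 -val_eqE /=; lia.
have [p hp] : exists p : 'I_n, (p + n./2 = i) \/ (p = i + n./2 :> nat).
  have [h'|h'] := leqP n./2 i.
    have h2 : i - n./2 < n by lia.
    by exists (Ordinal h2); left => /=; lia.
  have h2 : i + n./2 < n by lia.
  by exists (Ordinal h2); right.
have hp' := ltn_ord p.
have -> : [set j : 'I_n | i - j + (j - i) == n./2] = [set p].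
  by apply/setP => j; rewrite !inE -!val_eqE /=; have := ltn_ord j; lia.
by rewrite cards1.
Qed.

Definition circ_graph n m c : sgraph 'I_n := SGraph (rel_graph_card2 (circ n m c)).

Lemma circ_graph_deg n m (c : bool) i : m < n./2 ->
  deg (circ_graph n m c) i = m.*2 + c * (1 + (odd n && (i == n./2 :> nat))).
Proof.
move=> mn; rewrite deg_rel_graph; [|exact: circ_sym|exact: circ_irr].
by case: c; rewrite ?card_circ_half ?card_circ // ?mul1n ?mul0n ?addn0.
Qed.

(** * Maxima of the cubic [star_count] *)

Lemma star_countZ n d : d < n ->
  (star_count n d = d%:Z * (n%:Z - 1 - d%:Z) * (n%:Z - 2 - d%:Z) :> int)%R.
Proof.
move=> dn; rewrite /star_count.
have [M hM] : exists M, n = d + M.+1 by exists (n - d).-1; lia.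
have -> : n.-1 - d = M by lia.
(* [M] counts the non-neighbours. At [M = 0] the truncated predecessor is 0 instead of -1, but it is
   multiplied by 0. *)
rewrite hM; case: M {hM} => [|M] /=; last by nia.
by rewrite muln0; nia.
Qed.

(* Taylor expansion of the cubic [star_count n] at [a]. *)
Lemma star_count_drop n (a d : nat) : a < n -> d < n ->
  (let t := d%:Z - a%:Z in let u := n%:Z - 1 - a%:Z in
   (star_count n a)%:Z - (star_count n d)%:Z =
   t * (a%:Z * (2 * u - 1) - u * (u - 1) + (2 * u - 1 - a%:Z) * t - t ^+ 2))%R.
Proof. by move=> an dn /=; rewrite !star_countZ //; ring. Qed.

Lemma star_count_max n a d : a < n -> d < n ->
  (forall u t : int, u = n%:Z - 1 - a%:Z -> - a%:Z <= t <= u -> t != 0 ->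
   0 < t * (a%:Z * (2 * u - 1) - u * (u - 1) + (2 * u - 1 - a%:Z) * t - t ^+ 2))%R ->
  star_count n d <= star_count n a ?= iff (d == a).
Proof.
move=> an dn pos; apply/leqifP; case: eqVneq => [-> //|nda].
have := @star_count_drop n a d an dn => /= E.
have := pos _ (d%:Z - a%:Z)%R erefl; rewrite -E; lia.
Qed.

(** In each case with a unique maximum, the drop is [t] times a bracket that has the sign of [t] for
    every nonzero [t] in the allowed range. *)
Lemma star_count_max1 k d : 0 < k -> d < 6 * k + 1 ->
  star_count (6 * k + 1) d <= star_count (6 * k + 1) (2 * k) ?= iff (d == 2 * k).
Proof.
move=> k0 dn; apply: star_count_max => // [|u t uE tb t0]; first lia.
have -> : u = (4 * k%:Z)%R by lia.
have -> : (t * ((2 * k)%N%:Z * (2 * (4 * k%:Z) - 1) - 4 * k%:Z * (4 * k%:Z - 1) +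
  (2 * (4 * k%:Z) - 1 - (2 * k)%N%:Z) * t - t ^+ 2) =
  t * (2 * k%:Z + t * (6 * k%:Z - 1 - t)))%R by lia.
have [tp|tn] : (0 < t \/ t <= -1)%R by lia.
  by rewrite mulr_gt0 // ; nia.
nia.
Qed.

(** Take [a] least, so that [a <= x], and bound [b * c] by the inequality of the arithmetic and
    geometric means. The gaps [e] and [f] between [x], [y], [z] sum to at most 1, which leaves three
    shapes of balanced triple. *)
Lemma mul3_le_balanced x y z a b c :
  a + b + c = x + y + z -> x <= y -> y <= z -> z <= x.+1 ->
  a * b * c <= x * y * z.
Proof.
move=> abc xy yz zx.
wlog ab : a b c abc / a <= b => [hw|].
  have [ab|/ltnW ba] := leqP a b; first exact: hw.
  by rewrite (mulnC a); apply: hw => //; rewrite (addnC b).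
wlog ac : a b c abc ab / a <= c => [hw|].
  have [ac|/ltnW ca] := leqP a c; first exact: hw.
  rewrite mulnC mulnA; apply: hw; lia.
have [p xE] : exists p, x = a + p by exists (x - a); lia.
have [e yE] : exists e, y = x + e by exists (y - x); lia.
have [f zE] : exists f, z = y + f by exists (z - y); lia.
have [bc4 _] := nat_AGM2 b c; rewrite -mulnn in bc4.
have bcE : b + c = 2 * a + 3 * p + 2 * e + f by lia.
rewrite bcE in bc4.
have ab4 := leq_mul (leqnn a) bc4.
have [e0|e1] : e = 0 \/ (e = 1 /\ f = 0) by lia.
  have [f0|f1] : f = 0 \/ f = 1 by lia.
    subst; nia.
  (* When [p = 0], [b + c = 2 * a + 1] is odd and the mean bound exceeds [a * (a + 1)] by a quarter;
     integrality removes this excess. *)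
  have [p0|p1] : p = 0 \/ 0 < p by lia.
    subst.
    have : b * c <= a * (a + 1) by nia.
    nia.
  subst; nia.
case: e1 => ? ?; subst; nia.
Qed.

Lemma star_count_max2 k d : 0 < k -> d < 6 * k + 2 ->
  star_count (6 * k + 2) d <= star_count (6 * k + 2) (2 * k) ?= iff (d == 2 * k).
Proof.
move=> k0 dn; apply: star_count_max => // [|u t uE tb t0]; first lia.
have {}uE : u = (4 * k%:Z + 1)%R by lia.
rewrite uE in tb *.
rewrite [X in (_ < X)%R](_ : _ = t * (t * (6 * k%:Z + 1 - t) - 2 * k%:Z))%R; last by lia.
have [tp|tn] : (0 < t \/ t <= -1)%R by lia.
  by rewrite mulr_gt0 //; nia.
nia.
Qed.

Lemma star_count_max4 k d : d < 6 * k + 4 ->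
  star_count (6 * k + 4) d <= star_count (6 * k + 4) (2 * k + 1)
    ?= iff (d == 2 * k + 1).
Proof.
move=> dn; apply: star_count_max => // [|u t uE tb t0]; first lia.
have {}uE : u = (4 * k%:Z + 2)%R by lia.
rewrite uE in tb *.
rewrite [X in (_ < X)%R](_ : _ = t * (t * (6 * k%:Z + 2 - t) + (2 * k%:Z + 1)))%R;
  last by lia.
have [tp|tn] : (0 < t \/ t <= -1)%R by lia.
  by rewrite mulr_gt0 //; nia.
nia.
Qed.

(** The drop factors with [t * (t + 1)], where [t = d - 2k]. This vanishes exactly at the two
    optimal degrees and is positive at other integers; the third factor is positive since [d < 6k]
    and [k > 0]. *)
Lemma star_count_max0 k d : 0 < k -> d < 6 * k ->
  star_count (6 * k) d <= star_count (6 * k) (2 * k)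
    ?= iff (d == 2 * k - 1) || (d == 2 * k).
Proof.
move=> k0 dn; apply/leqifP.
have /= E := @star_count_drop (6 * k) (2 * k) d ltac:(lia) dn.
have {}E : ((star_count (6 * k) (2 * k))%:Z - (star_count (6 * k) d)%:Z =
   (d%:Z - 2 * k%:Z) * (d%:Z - 2 * k%:Z + 1) * (8 * k%:Z - 2 - d%:Z))%R.
  by rewrite E; lia.
have [/orP[]/eqP dE|/norP[d1 d2]] := boolP (_ || _).
- by rewrite dE in E *; nia.
- by rewrite dE.
have : (0 < (d%:Z - 2 * k%:Z) * (d%:Z - 2 * k%:Z + 1))%R.
  have [|] : d + 1 < 2 * k \/ 2 * k < d by lia.
    by nia.
  by nia.
nia.
Qed.

(** The same factorisation, now with [t * (t - 1)]. For [k = 0] the third factor would vanish at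
    [d = 2], giving a third optimal degree. *)
Lemma star_count_max3 k d : 0 < k -> d < 6 * k + 3 ->
  star_count (6 * k + 3) d <= star_count (6 * k + 3) (2 * k)
    ?= iff (d == 2 * k) || (d == 2 * k + 1).
Proof.
move=> k0 dn; apply/leqifP.
have /= E := @star_count_drop (6 * k + 3) (2 * k) d ltac:(lia) dn.
have {}E : ((star_count (6 * k + 3) (2 * k))%:Z - (star_count (6 * k + 3) d)%:Z =
   (d%:Z - 2 * k%:Z) * (d%:Z - 2 * k%:Z - 1) * (8 * k%:Z + 2 - d%:Z))%R.
  by rewrite E; lia.
have [/orP[]/eqP dE|/norP[d1 d2]] := boolP (_ || _).
- by rewrite dE.
- by rewrite dE in E *; nia.
have : (0 < (d%:Z - 2 * k%:Z) * (d%:Z - 2 * k%:Z - 1))%R.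
  have [|] : d < 2 * k \/ 2 * k + 1 < d by lia.
    by nia.
  by nia.
nia.
Qed.

Lemma star_count_max5 k d : d < 6 * k + 5 ->
  star_count (6 * k + 5) d <= star_count (6 * k + 5) (2 * k + 1)
    ?= iff (d == 2 * k + 1).
Proof.
move=> dn; apply: star_count_max => // [|u t uE tb t0]; first lia.
have {}uE : u = (4 * k%:Z + 3)%R by lia.
rewrite uE in tb *.
rewrite [X in (_ < X)%R](_ : _ = t * (t * (6 * k%:Z + 4 - t) - (2 * k%:Z + 1)))%R;
  last by lia.
have [tp|tn] : (0 < t \/ t <= -1)%R by lia.
  by rewrite mulr_gt0 //; nia.
nia.
Qed.

(** With [s = d - 2k - 1], the drop from [2k + 2] is [s - 1] times a bracket that is negative for
    [s <= -1] and positive for [s >= 2]. *)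
Lemma star_count_second5 k d : d < 6 * k + 5 -> d != 2 * k + 1 ->
  star_count (6 * k + 5) d <= star_count (6 * k + 5) (2 * k + 2)
    ?= iff (d == 2 * k + 2).
Proof.
move=> dn nd; apply/leqifP; case: eqVneq => [-> //|d2].
have /= E1 := @star_count_drop (6 * k + 5) (2 * k + 2) d ltac:(lia) dn.
have {}E1 : ((star_count (6 * k + 5) (2 * k + 2))%:Z - (star_count (6 * k + 5) d)%:Z =
   (d%:Z - 2 * k%:Z - 2) * ((6 * k%:Z + 3) * (d%:Z - 2 * k%:Z - 1) + 4 * k%:Z + 2
      - (d%:Z - 2 * k%:Z - 1) ^+ 2))%R.
  by rewrite E1; lia.
suff : (0 < (d%:Z - 2 * k%:Z - 2) * ((6 * k%:Z + 3) * (d%:Z - 2 * k%:Z - 1)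
   + 4 * k%:Z + 2 - (d%:Z - 2 * k%:Z - 1) ^+ 2))%R by lia.
have [|] : (d <= 2 * k \/ 2 * k + 2 < d) by lia.
  by move=> h; rewrite nmulr_rgt0; nia.
by move=> h; rewrite mulr_gt0; nia.
Qed.

(** * From bounds on the cubic to [pi3] and [LambdaMax] *)

Lemma pi3_balanced x y z :
  x <= y -> y <= z -> z <= x.+1 -> pi3 (x + y + z) = x * y * z.
Proof.
move=> xy yz zx; apply/eqP; rewrite eqn_leq; apply/andP; split.
  by apply/bigmax_leqP => t /eqP tE; apply: mul3_le_balanced tE _ _ _.
have hx : x < (x + y + z).+1 by lia.
have hy : y < (x + y + z).+1 by lia.
have hz : z < (x + y + z).+1 by lia.
exact: (leq_bigmax_cond (Ordinal hx, Ordinal hy, Ordinal hz)).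
Qed.

(** [P] ranges over all vertex types because extremal graphs are characterised on any [T] of size
    [n], while the maximum is taken over ['I_n]. *)
Lemma LambdaMax_extremal n B (P : forall T : finType, sgraph T -> Prop) :
  (forall (T : finType) (G : sgraph T), #|T| = n ->
     Lambda H G <= B /\ (Lambda H G = B <-> P T G)) ->
  (exists G : sgraph 'I_n, P _ G) ->
  LambdaMax H n = B /\
  (forall (T : finType) (G : sgraph T), #|T| = n ->
     Lambda H G = LambdaMax H n <-> P T G).
Proof.
move=> ub [G0 PG0].
have maxE : LambdaMax H n = B.
  apply/eqP; rewrite eqn_leq; apply/andP; split.
    by apply/bigmax_leqP => G _; case: (ub _ G (card_ord n)).
  have [_ [_ /(_ PG0) <-]] := ub _ G0 (card_ord n).
  exact: leq_bigmax.
by split=> // T G cT; rewrite maxE; case: (ub T G cT).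
Qed.

(** The bound is summed over the vertices; equality of the sums forces equality at every vertex. *)
Lemma LambdaMax_deg n B (D : pred nat) :
  (forall d, d < n -> star_count n d <= B ?= iff D d) ->
  (exists G : sgraph 'I_n, forall x, D (deg G x)) ->
  LambdaMax H n = n * B /\
  (forall (T : finType) (G : sgraph T), #|T| = n ->
     Lambda H G = LambdaMax H n <-> forall x, D (deg G x)).
Proof.
move=> ub; apply: (@LambdaMax_extremal _ _ (fun T G => forall x, D (deg G x))).
move=> T G cT.
have [] : Lambda H G <= n * B ?= iff [forall x, D (deg G x)].
  have -> : n * B = \sum_(x : T) B by rewrite sum_nat_const cT.
  rewrite LambdaE cT; apply: leqif_sum => x _.
  by apply: ub; rewrite -cT deg_lt.
move=> le eqE; split=> //; split=> [/eqP|Dx].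
  by rewrite eqE => /forallP.
by apply/eqP; rewrite eqE; apply/forallP.
Qed.

Lemma LambdaMax5 k : let n := 6 * k + 5 in
  LambdaMax H n = star_count n (2 * k + 2) + (6 * k + 4) * star_count n (2 * k + 1) /\
  (forall (T : finType) (G : sgraph T), #|T| = n ->
     Lambda H G = LambdaMax H n <->
     #|[set x | deg G x == 2 * k + 1]| = n - 1 /\
     #|[set x | deg G x == 2 * k + 2]| = 1).
Proof.
move=> n; apply: (@LambdaMax_extremal _ _ (fun T G =>
     #|[set x | deg G x == 2 * k + 1]| = n - 1 /\
     #|[set x | deg G x == 2 * k + 2]| = 1)); last first.
  (* Here [n] is odd, so only the middle vertex [n./2 = 3k + 2] gets degree [2k + 2]. *)
  exists (circ_graph n k true).
  have dE (x : 'I_n) : deg (circ_graph n k true) x = 2 * k + 1 + (x == 3 * k + 2 :> nat).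
    by rewrite circ_graph_deg /n; lia.
  have hm : 3 * k + 2 < n by rewrite /n; lia.
  have E2 : [set x | deg (circ_graph n k true) x == 2 * k + 2] = [set Ordinal hm].
    by apply/setP => x; rewrite !inE dE -val_eqE /=; lia.
  have E1 : [set x | deg (circ_graph n k true) x == 2 * k + 1] = ~: [set Ordinal hm].
    by apply/setP => x; rewrite !inE dE -val_eqE /=; lia.
  by rewrite E1 E2 cardsC1 cards1 card_ord subn1.
move=> T G cT.
have dlt x : deg G x < 6 * k + 5 by rewrite -[6 * k + 5]cT deg_lt.
have [x0 nx0] : exists x, deg G x != 2 * k + 1.
  apply/existsP; rewrite -negb_forall; apply: contra (sum_deg_even G) => /forallP h.
  rewrite (eq_bigr (fun=> 2 * k + 1)) => [|x _]; last exact/eqP/h.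
  by rewrite sum_nat_const cT /n; lia.
(* The exceptional vertex [x0] is bounded by the second best value, all others by the best one. *)
have [] : Lambda H G <= star_count n (2 * k + 2) + (6 * k + 4) * star_count n (2 * k + 1)
     ?= iff (deg G x0 == 2 * k + 2) && [forall (x | x != x0), deg G x == 2 * k + 1].
  rewrite LambdaE (bigD1 x0) //= cT.
  have -> : 6 * k + 4 = #|predC1 x0| by rewrite cardC1 cT /n; lia.
  rewrite -sum_nat_const; apply: leqif_add.
    exact: star_count_second5.
  apply: leqif_sum => x _.
  exact: star_count_max5.
move=> le eqE; split=> //.
transitivity ((deg G x0 == 2 * k + 2) && [forall (x | x != x0), deg G x == 2 * k + 1]).
  by rewrite -eqE; split=> /eqP.
split=> [/andP[/eqP d0 /forall_inP dx]|[c1 c2]].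
  have E2 : [set x | deg G x == 2 * k + 2] = [set x0].
    apply/setP => x; rewrite !inE; case: (eqVneq x x0) => [->|/dx/eqP->]; lia.
  have E1 : [set x | deg G x == 2 * k + 1] = ~: [set x0].
    apply/setP => x; rewrite !inE; case: (eqVneq x x0) => [->|/dx/eqP->]; lia.
  by rewrite E1 E2 cardsC1 cards1 cT subn1.
(* The [n - 1] vertices of degree [2k + 1] avoid [x0], hence are all the others; the vertex of
   degree [2k + 2] must then be [x0]. *)
have E1 : [set x | deg G x == 2 * k + 1] = ~: [set x0].
  apply/eqP; rewrite eqEcard cardsC1 c1 cT subn1 leqnn andbT.
  by apply/subsetP => x; rewrite !inE; apply: contraTneq => ->.
have dx x : x != x0 -> deg G x == 2 * k + 1.
  move=> nx; have : x \in [set~ x0] by rewrite !inE.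
  by rewrite -E1 inE.
apply/andP; split; last by apply/forall_inP.
have /eqP/cards1P[y Ey] := c2.
have : y \in [set x | deg G x == 2 * k + 2] by rewrite Ey set11.
rewrite inE; case: (eqVneq y x0) => [-> //|/dx/eqP->]; lia.
Qed.

(** Doubling clears the denominators, so each rational formula reduces to an integer identity with
    deficit [c]. *)
Lemma natr_half (L n p : nat) (c : int) :
  (2 * L%:Z = n%:Z * p%:Z - c)%R -> (L%:R = n%:R * p%:R / 2 - c%:~R / 2 :> rat)%R.
Proof.
move/(congr1 (fun z : int => (z%:~R : rat)%R)).
rewrite rmorphB !rmorphM /= -!pmulrn => E.
by rewrite -mulrBl -E mulrAC mulfV // mul1r.
Qed.

(** The factors [2d], [n - 1 - d] and [n - 2 - d] sum to [2n - 3]; when they are balanced, [p] is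
    [pi3 (2 * n - 3)]. Excluding [c] with odd [n] keeps the circulant graph regular. *)
Lemma LambdaMax_regular n d p m (c : bool) :
  (forall e, e < n -> star_count n e <= star_count n d ?= iff (e == d)) ->
  d < n -> m < n./2 -> ~~ (c && odd n) -> d = m.*2 + c ->
  (2 * d%:Z * (n%:Z - 1 - d%:Z) * (n%:Z - 2 - d%:Z) = p%:Z :> int)%R ->
  ((LambdaMax H n)%:R = n%:R * p%:R / 2 :> rat)%R /\
  (forall (T : finType) (G : sgraph T), #|T| = n ->
     Lambda H G = LambdaMax H n <-> regular G d).
Proof.
move=> ub dn mn cn dE pE.
have [|LE char] := @LambdaMax_deg n _ (pred1 d) ub.
  exists (circ_graph n m c) => x; rewrite /= circ_graph_deg // dE.
  by case: c cn {dE} => /= [/negbTE ->|_]; rewrite ?mul1n ?mul0n ?addn0.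
split.
  rewrite (@natr_half _ n p 0%R) ?mul0r ?subr0 // LE -pE PoszM star_countZ //; ring.
move=> T G /char ->; split=> Gd x; first exact/eqP/Gd.
by apply/eqP/Gd.
Qed.

(** * The residue classes of [n] modulo 6 *)

Local Open Scope ring_scope.

Theorem lemma3p4 (n : nat) (hn : (4 <= n)%N) :
  [/\ (n %% 6)%N \in [:: 1; 2; 4]%N ->
        (LambdaMax H n)%:R = n%:R * (pi3 (2 * n - 3))%:R / 2 :> rat /\
        (forall (T : finType) (G : sgraph T), #|T| = n ->
           Lambda H G = LambdaMax H n <-> regular G (n %/ 3)%N),
      forall k : int, n%:Z = 6 * k ->
        (LambdaMax H n)%:R = n%:R * (pi3 (2 * n - 3))%:R / 2
                             - 3 * k%:~R * (4 * k%:~R - 1) :> rat /\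
        (forall (T : finType) (G : sgraph T), #|T| = n ->
           Lambda H G = LambdaMax H n <->
           forall x : T, (deg G x)%:Z = 2 * k - 1 \/ (deg G x)%:Z = 2 * k),
      forall k : int, n%:Z = 6 * k + 3 ->
        (LambdaMax H n)%:R = n%:R * (pi3 (2 * n - 3))%:R / 2
                             - (6 * k%:~R + 3) * (4 * k%:~R + 1) / 2 :> rat /\
        (forall (T : finType) (G : sgraph T), #|T| = n ->
           Lambda H G = LambdaMax H n <->
           forall x : T, (deg G x)%:Z = 2 * k \/ (deg G x)%:Z = 2 * k + 1)
    & forall k : int, n%:Z = 6 * k + 5 ->
        (LambdaMax H n)%:R = n%:R * (pi3 (2 * n - 3))%:R / 2
                             - 4 * k%:~R - 2 :> rat /\
        (forall (T : finType) (G : sgraph T), #|T| = n ->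
           Lambda H G = LambdaMax H n <->
           #|[set x : T | (deg G x)%:Z == 2 * k + 1]| = (n - 1)%N /\
           #|[set x : T | (deg G x)%:Z == 2 * k + 2]| = 1%N)].
Proof.
split.
- move=> n6.
  have [k nk] : exists k, [\/ n = 6 * k + 1 /\ (0 < k), n = 6 * k + 2 /\ (0 < k) |
                             n = 6 * k + 4]%N.
    by exists (n %/ 6)%N; move: n6; rewrite !inE => /or3P[]/eqP ?;
      [apply: Or31|apply: Or32|apply: Or33]; lia.
  case: nk => [[-> k0]|[-> k0]|->].
  + have -> : ((6 * k + 1) %/ 3 = 2 * k)%N by lia.
    have [p1 p2 p3] : [/\ (4 * k - 1 <= 4 * k), (4 * k <= 4 * k) &
       (4 * k <= (4 * k - 1).+1)]%N by split; lia.
    have -> : (2 * (6 * k + 1) - 3 = (4 * k - 1) + 4 * k + 4 * k)%N by lia.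
    rewrite pi3_balanced //; apply: (@LambdaMax_regular _ _ _ k false); try lia.
    by move=> e; exact: star_count_max1.
  + have -> : ((6 * k + 2) %/ 3 = 2 * k)%N by lia.
    have -> : (2 * (6 * k + 2) - 3 = 4 * k + 4 * k + (4 * k).+1)%N by lia.
    rewrite pi3_balanced //; apply: (@LambdaMax_regular _ _ _ k false); try lia.
    by move=> e; exact: star_count_max2.
  + have -> : ((6 * k + 4) %/ 3 = 2 * k + 1)%N by lia.
    have -> : (2 * (6 * k + 4) - 3 = (4 * k).+1 + (4 * k).+2 + (4 * k).+2)%N by lia.
    rewrite pi3_balanced //; apply: (@LambdaMax_regular _ _ _ k true); try lia.
    by move=> e; exact: star_count_max4.
- move=> k' nk.
  have [k kE] : exists k : nat, k' = k%:Z by exists `|k'|%N; lia.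
  have {nk}nk : n = (6 * k)%N by lia.
  have k0 : (0 < k)%N by lia.
  subst n k'.
  have [|LE char] := @LambdaMax_deg (6 * k) _ _ (fun d => @star_count_max0 k d k0).
    exists (circ_graph (6 * k) k false) => x; rewrite /= circ_graph_deg ?mul0n; lia.
  split; last first.
    move=> T G cT; rewrite char //; split=> h x.
      have := h x; lia.
    have := h x; lia.
  have -> : (2 * (6 * k) - 3 = (4 * k - 1) + (4 * k - 1) + (4 * k - 1))%N by lia.
  rewrite pi3_balanced //.
  (* For [d = 2k] the factors are [4k - 2], [4k - 1], [4k], whose product is [4k - 1] below the cube
     of [4k - 1]; this deficit occurs at each of the [6k] vertices. *)
  rewrite (@natr_half _ (6 * k)%N ((4 * k - 1) * (4 * k - 1) * (4 * k - 1))%N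
    (6 * k%:Z * (4 * k%:Z - 1))).
    by rewrite !rmorphM rmorphB /= rmorphM /=; field.
  rewrite LE PoszM star_countZ; last by lia.
  lia.
- move=> k' nk.
  have [k kE] : exists k : nat, k' = k%:Z by exists `|k'|%N; lia.
  have {nk}nk : n = (6 * k + 3)%N by lia.
  (* [k = 0] would give [n = 3], against [hn]. *)
  have k0 : (0 < k)%N by lia.
  subst n k'.
  have [|LE char] := @LambdaMax_deg (6 * k + 3) _ _ (fun d => @star_count_max3 k d k0).
    exists (circ_graph (6 * k + 3) k false) => x; rewrite /= circ_graph_deg ?mul0n; lia.
  split; last first.
    move=> T G cT; rewrite char //; split=> h x.
      have := h x; lia.
    have := h x; lia.
  have -> : (2 * (6 * k + 3) - 3 = (4 * k + 1) + (4 * k + 1) + (4 * k + 1))%N by lia.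
  rewrite pi3_balanced //.
  rewrite (@natr_half _ (6 * k + 3)%N ((4 * k + 1) * (4 * k + 1) * (4 * k + 1))%N
    ((6 * k%:Z + 3) * (4 * k%:Z + 1))).
    by rewrite !rmorphM !rmorphD /= !rmorphM /=; field.
  rewrite LE PoszM star_countZ; last by lia.
  lia.
- move=> k' nk.
  have [k kE] : exists k : nat, k' = k%:Z by exists `|k'|%N; lia.
  have {nk}nk : n = (6 * k + 5)%N by lia.
  subst n k'.
  have [LE char] := LambdaMax5 k.
  split; last first.
    exact: char.
  have -> : (2 * (6 * k + 5) - 3 = (4 * k).+2 + (4 * k).+2 + (4 * k).+3)%N by lia.
  rewrite pi3_balanced //.
  (* Only the exceptional vertex loses: going from degree [2k + 1] to [2k + 2] costs [4k + 2], which
     is doubled here. *)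
  rewrite (@natr_half _ (6 * k + 5)%N ((4 * k).+2 * (4 * k).+2 * (4 * k).+3)%N
    (8 * k%:Z + 4)).
    by rewrite !rmorphD !rmorphM /=; field.
  rewrite LE PoszD PoszM !star_countZ; lia.
Qed.
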